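(* Let $S$ be a Hermitian symmetric operator with dense domain in a Hilbert space $H$, and assume that $S$ has deficiency indices $(1,1)$. Then all the self-adjoint extensions of $S$ have Cayley transform $$U=V\oplus W,$$ where $V$ is the Cayley transform of $S$ and where $W$ has $W^*W$ and $WW^*$ of rank $1$. Moreover, there exists $\alpha\in\mathbb C$, $|\alpha|<1$, such that $$W^2=\alpha W.$$
   Context: $H$ is a countably infinite-dimensional Hilbert space. A linear operator $S$ with dense domain $\mathcal D\subseteq H$ is Hermitian if $\langle S\xi_1,\xi_2\rangle=\langle\xi_1,S\xi_2\rangle$ for all $\xi_1,\xi_2\in\mathcal D$. An extension $T$ of $S$ is an operator whose graph contains the graph of $S$. The Cayley transform of $S$ is $V=(S+i)(S-i)^{-1}$, i.e. $V(S\xi-i\xi)=S\xi+i\xi$ for $\xi\in\mathcal D$, regarded as a partial isometry on $H$; the orthogonal complements of its initial space (range of $V^*V$) and of its final space (range of $VV^*$) are the defect spaces $\mathcal E_+=\ker(S^*-i)$ and $\mathcal E_-=\ker(S^*+i)$, respectively, and the deficiency indices are $n_\pm=\dim\mathcal E_\pm$. The Cayley transform of a self-adjoint extension $T$ of $S$ is the unitary $U=(T+i)(T-i)^{-1}$, which extends $V$. In $U=V\oplus W$, $W$ is the partial isometry with initial space $\mathcal E_+$ and final space $\mathcal E_-$ by which $U$ extends $V$. *)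

(* Defs.v *)
From HB Require Import structures.
From mathcomp Require Import all_boot all_order all_algebra.
From mathcomp Require Import all_classical all_reals all_analysis.
From mathcomp Require Import complex.

Set Implicit Arguments.
Unset Strict Implicit.
Unset Printing Implicit Defensive.

Import Order.TTheory GRing.Theory Num.Theory.
Import numFieldNormedType.Exports.

Local Open Scope classical_set_scope.
Local Open Scope complex_scope.
Local Open Scope ring_scope.

(* A complex Hilbert space is a complete normed space [H] over [R[i]] together
   with an inner product [ip : {dot H for Num.conj}] inducing its norm.
   Library convention: [ip] is linear in its first argument. *)

(* A linear operator defined on a linear subspace of [H]; the values of
   [op_fun] outside [dom] are irrelevant. *)
Record operator (R : realType) (H : lmodType R[i]) := Operator {
  dom : set H;
  op_fun :> H -> H;
  dom0 : dom 0;
  dom_linear : forall (a : R[i]) x y, dom x -> dom y -> dom (a *: x + y);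
  op_linear : forall (a : R[i]) x y, dom x -> dom y ->
    op_fun (a *: x + y) = a *: op_fun x + op_fun y
}.

Section HilbertSpaceOperators.
Variables (R : realType) (H : completeNormedModType R[i]).
Variable ip : {dot H for (@Num.conj R[i])}.
Implicit Types (S T : operator H) (A : set H) (U V W : H -> H).

Definition hilbert_norm := forall x : H, `|x| ^+ 2 = ip x x.

Definition countably_infinite_dim := exists e : nat -> H,
  (forall i j, ip (e i) (e j) = (i == j)%:R) /\
  dense [set x | exists n (c : nat -> R[i]), x = \sum_(i < n) c i *: e i].

(* Dimension is algebraic; only finite values are expressed. *)
Definition has_dim A (n : nat) := exists e : 'I_n -> H,
  (forall c : 'I_n -> R[i], \sum_i c i *: e i = 0 -> forall i, c i = 0) /\
  A = [set \sum_i c i *: e i | c in [set: 'I_n -> R[i]]].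

Definition orthocomp A : set H := [set y | forall x, A x -> ip x y = 0].

Definition op_graph S : set (H * H) := [set (x, S x) | x in dom S].

Definition extends T S := op_graph S `<=` op_graph T.

Definition hermitian_op S :=
  dense (dom S) /\ forall x y, dom S x -> dom S y -> ip (S x) y = ip x (S y).

(* The graph of the adjoint S^*, for densely defined S. *)
Definition adjoint_graph S : set (H * H) :=
  [set p | forall x, dom S x -> ip (S x) p.1 = ip x p.2].

Definition self_adjoint T :=
  dense (dom T) /\ op_graph T = adjoint_graph T.

(* ker(S^* - z) *)
Definition defect_space S (z : R[i]) : set H :=
  [set y | adjoint_graph S (y, z *: y)].

Definition deficiency_indices S (m n : nat) :=
  has_dim (defect_space S 'i) m /\ has_dim (defect_space S (- 'i)) n.

(* The adjoint of a bounded everywhere-defined operator; such an adjoint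
   always exists and is unique, so the default value 0 is never used. *)
Definition adj V (y : H) : H := xget 0 [set z | forall x, ip (V x) y = ip x z].

Definition unitary U :=
  (forall x, adj U (U x) = x) /\ (forall x, U (adj U x) = x).

Definition rank_is V n := has_dim (range V) n.

(* V^* V is a projection. *)
Definition partial_isometry (V : {linear H -> H}) :=
  continuous V /\ (adj V \o V) \o (adj V \o V) =1 adj V \o V.

Definition initial_space V : set H := range (adj V \o V).

Definition final_space V : set H := range (V \o adj V).

(* The graph of (S + i)(S - i)^-1. *)
Definition cayley_graph S : set (H * H) :=
  [set (S x - 'i *: x, S x + 'i *: x) | x in dom S].

(* (S + i)(S - i)^-1 as a partial isometry of [H]: it is extended by continuity
   to the closure of the range of S - i, which is its initial space (S is not
   assumed to be closed). These conditions determine [V]. *)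
Definition cayley_transform S (V : {linear H -> H}) :=
  [/\ partial_isometry V,
      initial_space V = closure [set S x - 'i *: x | x in dom S] &
      forall x, dom S x -> V (S x - 'i *: x) = S x + 'i *: x].

(* For self-adjoint T, (T + i)(T - i)^-1 itself is everywhere defined. *)
Definition unitary_cayley_transform T (U : {linear H -> H}) :=
  unitary U /\ [set (x, U x) | x in [set: H]] = cayley_graph T.

(* U = V (+) W: W maps the orthogonal complement of the initial space of V
   isometrically onto the orthogonal complement of its final space. *)
Definition is_orthosum U V (W : {linear H -> H}) :=
  [/\ partial_isometry W,
      initial_space W = orthocomp (initial_space V),
      final_space W = orthocomp (final_space V) &
      forall x, U x = V x + W x].

End HilbertSpaceOperators.

(* Main.v *)
Require Import Defs.
From HB Require Import structures.
From mathcomp Require Import all_boot all_order all_algebra.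
From mathcomp Require Import all_classical all_reals all_analysis.
From mathcomp Require Import complex.
From mathcomp Require Import ring.

(** Everything happens in graphs. The Cayley graph of an operator S is the
    linear relation G = {(S x - i x, S x + i x)}; it is isometric exactly because
    S is Hermitian: the cross terms of |S x - i x|^2 and |S x + i x|^2 vanish
    when <S x, x> is real. The orthocomplements of its domain and of its
    codomain are ker (S^* + i) and ker (S^* - i) ([cayley_dom_orthocomp],
    [cayley_cod_orthocomp]).

    Any isometric linear relation G has a zero extension: the operator that
    follows the closure of G on the closure M of its domain and vanishes on the
    orthocomplement of M. It is everywhere defined because H is complete, which
    gives both the limits along G ([closure_rel_dom]) and the projection onto M
    ([orthogonal_projection]). The zero extensions of G and of its converse are
    adjoint to each other ([zero_extension_ip]) and compose to the projection
    onto M ([zero_extension_adjK]): a zero extension is a partial isometry whose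
    initial and final spaces are the closures of the domain and codomain of G.

    The three operators of the theorem are zero extensions. V comes from the
    Cayley graph of S and U from that of T. For self-adjoint T the Cayley graph
    is closed and its domain and codomain have trivial orthocomplements, since
    T y = i y or T y = - i y would put a pair (0, y) or (y, 0) with y <> 0 in an
    isometric relation; so U is unitary. W comes from the pairs of the Cayley
    graph of T whose first component is orthogonal to the range of S - i. As U is
    unitary and extends V, it maps ker (S^* + i) onto ker (S^* - i); these are
    the initial and final spaces of W, and U = V + W ([cayley_extension_sum]).

    Finally let ker (S^* - i) be spanned by f. It is the range of W, so
    W f = alpha f for some alpha, and then W^2 = alpha W. As W is a contraction,
    |alpha| <= 1. Equality would put f in the initial space of W, hence in both
    defect spaces; then f is orthogonal to S x - i x and to S x + i x for every x,
    so to the dense domain of S, and f = 0 ([cayley_orthocomp_eq0]). *)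

Set Implicit Arguments.
Unset Strict Implicit.
Unset Printing Implicit Defensive.

Import Order.TTheory GRing.Theory Num.Theory.
Import numFieldNormedType.Exports.

Local Open Scope complex_scope.
Local Open Scope ring_scope.
Local Open Scope classical_set_scope.

(** * Linear subspaces and closures in normed modules *)

Definition linear_subspace (K : numFieldType) (E : lmodType K) (A : set E) :=
  A 0 /\ forall a x y, A x -> A y -> A (a *: x + y).

Section LinearSubspace.
Variables (K : numFieldType) (E : lmodType K) (A : set E).
Hypothesis A_lin : linear_subspace A.

Lemma subspaceZ a x : A x -> A (a *: x).
Proof. by case: A_lin => A0 AL Ax; rewrite -[_ *: _]addr0; apply: AL. Qed.

Lemma subspaceD x y : A x -> A y -> A (x + y).
Proof. by case: A_lin => _ AL Ax Ay; rewrite -[x]scale1r; apply: AL. Qed.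

Lemma subspaceB x y : A x -> A y -> A (x - y).
Proof. by move=> Ax Ay; rewrite -scaleN1r addrC; case: A_lin => _; apply. Qed.

End LinearSubspace.

Lemma norm_lt_eq0 (K : numFieldType) (E : normedZmodType K) (x : E) :
  (forall e, 0 < e -> `|x| < e) -> x = 0.
Proof.
move=> xe; apply/eqP; rewrite -normr_le0; apply/ler_addgt0Pr => e e0.
by rewrite add0r ltW// xe.
Qed.

Lemma add_sub_inj (K : numFieldType) (a a' b b' : K) :
  a + a' = b + b' -> a - a' = b - b' -> a = b.
Proof.
have avg (x y : K) : x = (x + y + (x - y)) / 2.
  by field.
by move=> ab ab'; rewrite [LHS](avg _ a') ab ab' -avg.
Qed.

Section NormClosure.
Variables (K : numFieldType) (E : normedModType K).
Implicit Types A : set E.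

Lemma closure_normP A x :
  closure A x <-> forall e, 0 < e -> exists2 a, A a & `|x - a| < e.
Proof.
split=> [clA e e0|H B /nbhs_ballP[e /= e0 eB]].
  have [|a [Aa xa]] := clA (ball x e); first exact: nbhsx_ballx.
  by exists a => //; move: xa; rewrite -ball_normE.
have [a Aa xa] := H e e0; exists a; split=> //; apply: eB.
by rewrite -ball_normE.
Qed.

Lemma closure_subspace A : linear_subspace A -> linear_subspace (closure A).
Proof.
move=> A_lin; split=> [|a x y]; first by apply: subset_closure; case: A_lin.
move=> /closure_normP Ax /closure_normP Ay; apply/closure_normP => e e0.
have a0 : 0 < `|a| + 1 by rewrite ltr_wpDl.
have [|x' Ax' xx'] := Ax (e / 2 / (`|a| + 1)); first by rewrite !divr_gt0.
have [|y' Ay' yy'] := Ay (e / 2); first by rewrite divr_gt0.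
exists (a *: x' + y'); first by case: A_lin => _; apply.
rewrite opprD addrACA -scalerBr (le_lt_trans (ler_normD _ _))//.
rewrite [ltRHS](splitr e) ler_ltD//.
rewrite normrZ; apply: (@le_trans _ _ ((`|a| + 1) * `|x - x'|)).
  by rewrite ler_wpM2r// lerDl.
by rewrite mulrC -ler_pdivlMr// ltW.
Qed.

Lemma dense_closure A : dense A -> closure A = setT.
Proof.
move=> dA; apply/seteqP; split=> // x _ B xB.
have [||y [yB Ay]] := dA B°; [by exists x|exact: open_interior|].
by exists y; split=> //; apply: interior_subset.
Qed.

End NormClosure.

(** Cantor's intersection theorem. The sets are indexed by positive scalars, like
    balls, so that they form a base of a Cauchy filter. *)
Lemma nested_closure (K : numFieldType) (E : completeNormedModType K)
    (B : K -> set E) :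
    (forall e, 0 < e -> B e !=set0) ->
    (forall e e', 0 < e -> e <= e' -> B e `<=` B e') ->
    (forall e, 0 < e -> exists2 d, 0 < d &
       forall x y, B d x -> B d y -> `|x - y| < e) ->
  exists l, forall e, 0 < e -> closure (B e) l.
Proof.
move=> B0 Bmono Bdiam.
pose F := filter_from [set e : K | 0 < e] B.
have FF : ProperFilter F.
  apply: filter_from_proper => //; apply: filter_from_filter.
    by exists 1 => /=.
  move=> e e' /= e0 e'0.
  have [|ee'] := real_leP (gtr0_real e0) (gtr0_real e'0).
    by exists e => // x Bx; split=> //; apply: Bmono Bx.
  by exists e' => // x Bx; split=> //; apply: Bmono Bx => //; apply: ltW.
have Fc : cauchy F.
  apply: cauchy_exP => e e0; have [d d0 Bd] := Bdiam e e0.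
  have [x Bx] := B0 d d0; exists x; exists d => // y By.
  by rewrite -ball_normE /=; apply: Bd.
have /cvg_ex[l Fl] := @cauchy_cvg E F FF Fc.
exists l => e e0 D lD; have [d /= d0 dD] := Fl D lD.
have [ed|/ltW de] := real_leP (gtr0_real e0) (gtr0_real d0).
  by have [x Bx] := B0 e e0; exists x; split=> //; apply: dD; apply: Bmono Bx.
by have [x Bx] := B0 d d0; exists x; split; [apply: Bmono Bx|apply: dD].
Qed.

(** * Inner products and orthogonal projections *)

Section InnerProduct.
Variables (R : realType) (H : completeNormedModType R[i]).
Variable ip : {dot H for (@Num.conj R[i])}.
Hypothesis ip_norm : hilbert_norm ip.
Implicit Types (A M : set H) (x y z : H) (V : H -> H).

Lemma ipC x y : ip x y = (ip y x)^*.
Proof. by rewrite hermC /= expr0 mul1r. Qed.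

Lemma ipZl a x y : ip (a *: x) y = a * ip x y.
Proof. exact: linearZl_LR. Qed.

Lemma ipZr a x y : ip x (a *: y) = a^* * ip x y.
Proof. exact: linearZr_LR. Qed.

Lemma ipDl x y z : ip (x + y) z = ip x z + ip y z.
Proof. exact: linearDl. Qed.

Lemma ipBl x y z : ip (x - y) z = ip x z - ip y z.
Proof. exact: linearBl. Qed.

Lemma ipDr x y z : ip x (y + z) = ip x y + ip x z.
Proof. exact: linearDr. Qed.

Lemma ipBr x y z : ip x (y - z) = ip x y - ip x z.
Proof. exact: linearBr. Qed.

Lemma ip0r x : ip x 0 = 0.
Proof. exact: linear0r. Qed.

Lemma ip_eq0 x : ip x x = 0 -> x = 0.
Proof. by rewrite -ip_norm => /eqP; rewrite sqrf_eq0 normr_eq0 => /eqP. Qed.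

Lemma ip_eq0C x y : ip x y = 0 -> ip y x = 0.
Proof. by move=> xy; rewrite ipC xy conjC0. Qed.

Lemma norm_sqrB x y :
  `|x - y| ^+ 2 = `|x| ^+ 2 + `|y| ^+ 2 - (ip x y + (ip x y)^*).
Proof. by rewrite !ip_norm dnormB. Qed.

Lemma norm_sqrD x y :
  `|x + y| ^+ 2 = `|x| ^+ 2 + `|y| ^+ 2 + (ip x y + (ip x y)^*).
Proof. by rewrite !ip_norm dnormD. Qed.

Lemma parallelogram x y :
  `|x + y| ^+ 2 + `|x - y| ^+ 2 = (`|x| ^+ 2 + `|y| ^+ 2) *+ 2.
Proof. by rewrite norm_sqrD norm_sqrB; ring. Qed.

(** If x is within e^2 of minimising |x - t y|^2 over t, then x is nearly
    orthogonal to y. The optimal t lowers |x|^2 by |<x, y>|^2 / |y|^2, and there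
    is only e^2 to lose. With d = 0 this is the Cauchy-Schwarz inequality; with d
    the squared distance to a subspace it makes almost nearest points almost
    orthogonal projections. *)
Lemma ip_near_minimal (d e : R[i]) x y : 0 <= e ->
    (forall t, d <= `|x - t *: y| ^+ 2) -> `|x| ^+ 2 <= d + e ^+ 2 ->
  `|ip x y| <= e * `|y|.
Proof.
move=> e0 dmin xe; have [->|y0] := eqVneq y 0.
  by rewrite ip0r normr0 mulr_ge0.
have ny0 : 0 < `|y| by rewrite normr_gt0.
(* the choice of t that minimises the quadratic *)
have := dmin (ip x y / `|y| ^+ 2); rewrite norm_sqrB ipZr.
set c := ip x y.
have -> : (c / `|y| ^+ 2)^* * c = `|c| ^+ 2 / `|y| ^+ 2.
  rewrite rmorphM /= [(_^-1)^*]geC0_conj ?invr_ge0 ?exprn_ge0// normCK.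
  by rewrite mulrAC [c * _]mulrC.
rewrite [(_ / _)^*]geC0_conj ?divr_ge0 ?exprn_ge0//.
rewrite normrZ normrM normfV normrX normr_id.
have -> : (`|c| / `|y| ^+ 2 * `|y|) ^+ 2 = `|c| ^+ 2 / `|y| ^+ 2.
  by rewrite !exprMn exprVn -mulrA; congr (_ * _); field; rewrite gt_eqF.
rewrite opprD addrA addrK lerBrDr => dle.
have : `|c| ^+ 2 / `|y| ^+ 2 <= e ^+ 2.
  by rewrite -(lerD2l d); apply: le_trans dle xe.
rewrite ler_pdivrMr ?exprn_gt0// -exprMn => le2.
by rewrite -(ler_sqr (normr_ge0 _)) // nnegrE mulr_ge0.
Qed.

Lemma cauchy_schwarz x y : `|ip x y| <= `|x| * `|y|.
Proof.
by apply: (@ip_near_minimal 0) => [//|t|]; rewrite ?add0r ?exprn_ge0.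
Qed.

Lemma orthocomp_closure A : orthocomp ip (closure A) = orthocomp ip A.
Proof.
apply/seteqP; split=> [y Ay x Ax|y Ay x /closure_normP clx].
  by apply: Ay; apply: subset_closure.
apply: norm_lt_eq0 => e e0; have y0 : 0 < `|y| + 1 by rewrite ltr_wpDl.
have [|a Aa xa] := clx (e / (`|y| + 1)); first by rewrite divr_gt0.
rewrite -(subrK a x) ipDl (Ay a Aa) addr0.
rewrite (le_lt_trans (cauchy_schwarz _ _))//.
apply: (@le_lt_trans _ _ (`|x - a| * (`|y| + 1))).
  by rewrite ler_wpM2l// lerDl.
by rewrite -ltr_pdivlMr.
Qed.

Lemma ip_dense_eq0 A y : dense A -> (forall x, A x -> ip x y = 0) -> y = 0.
Proof.
move=> /dense_closure dA Ay; have : orthocomp ip setT y.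
  by rewrite -dA orthocomp_closure.
by move=> /(_ y I); apply: ip_eq0.
Qed.

(** The infimum is taken among the real parts, the scalars R[i] being only
    partially ordered. *)
Lemma dist_inf M x : M !=set0 -> exists d : R[i],
  (forall m, M m -> d <= `|x - m| ^+ 2) /\
  (forall e, 0 < e -> exists2 m, M m & `|x - m| ^+ 2 <= d + e).
Proof.
move=> [m0 Mm0]; pose D := [set complex.Re (`|x - m| ^+ 2) | m in M].
have DE m : (complex.Re (`|x - m| ^+ 2))%:C%C = `|x - m| ^+ 2.
  by rewrite RRe_real// rpredX// normr_real.
have Dlb : lbound D 0.
  by move=> _ [m _ <-]; rewrite -lecR DE exprn_ge0.
have Dinf : has_inf D.
  by split; [exists (complex.Re (`|x - m0| ^+ 2)), m0|exists 0].
exists (inf D)%:C%C; split=> [m Mm|e e0].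
  by rewrite -DE lecR; apply: ge_inf; [exists 0|exists m].
have eE : (complex.Re e)%:C%C = e by rewrite RRe_real// gtr0_real.
have [|_ [m Mm <-] me] := @inf_adherent R D (complex.Re e) _ Dinf.
  by rewrite -ltcR eE.
by exists m => //; rewrite -DE -eE -rmorphD lecR ltW.
Qed.

(** The points of M that almost minimise the distance to x form sets whose
    diameters tend to 0, by the parallelogram identity, and x minus such a point
    is almost orthogonal to M; p is their limit. *)
Theorem orthogonal_projection M x : linear_subspace M ->
  exists2 p, closure M p & orthocomp ip M (x - p).
Proof.
move=> M_lin; have [|d [dmin dadh]] := @dist_inf M x.
  by exists 0; case: M_lin.
pose B e := [set m | M m /\ `|x - m| ^+ 2 <= d + e ^+ 2].
have [e e0|e e' e0 ee' m [Mm me]|e e0|p Bp] := @nested_closure _ H B.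
- by have [|m Mm me] := dadh (e ^+ 2); [rewrite exprn_gt0|exists m].
- split=> //; rewrite (le_trans me)// lerD2l ler_sqr// nnegrE ltW//.
  exact: lt_le_trans ee'.
(* the parallelogram identity bounds |m - m'| by twice the index of B *)
- exists (e / 3); first by rewrite divr_gt0.
  move=> m m' [Mm me] [Mm' me'].
  have mid : d <= `|x - 2^-1 *: (m + m')| ^+ 2.
    by apply: dmin; apply: subspaceZ => //; apply: subspaceD.
  have par : `|m - m'| ^+ 2 = (`|x - m'| ^+ 2 + `|x - m| ^+ 2) *+ 2
      - 4 * `|x - 2^-1 *: (m + m')| ^+ 2.
    have -> : m - m' = (x - m') - (x - m).
      by rewrite opprB [RHS]addrC subrKA.
    have -> : 4 * `|x - 2^-1 *: (m + m')| ^+ 2 = `|(x - m') + (x - m)| ^+ 2.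
      have -> : (x - m') + (x - m) = 2 *: (x - 2^-1 *: (m + m')).
        rewrite scalerBr scalerA divff ?pnatr_eq0// scale1r scaler_nat mulr2n.
        by rewrite addrACA opprD [- m' - m]addrC.
      by rewrite normrZ exprMn normr_nat -natrX.
    by rewrite -parallelogram [RHS]addrAC subrr add0r.
  rewrite -(ltr_sqr (normr_ge0 _)) ?nnegrE ?ltW// par.
  apply: (@le_lt_trans _ _ (4 * (e / 3) ^+ 2)).
    pose b := d + (e / 3) ^+ 2; apply: (@le_trans _ _ ((b + b) *+ 2 - 4 * d)).
      by rewrite lerB ?ler_wMn2r ?lerD// ler_pM2l.
    by rewrite le_eqVlt /b; apply/orP; left; apply/eqP; ring.
  rewrite expr_div_n mulrCA -[ltRHS]mulr1 ltr_pM2l ?exprn_gt0//.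
  by rewrite ltr_pdivrMr// mul1r -natrX ltr_nat.
exists p; first by apply: closure_subset (Bp 1 ltr01) => m [].
move=> m Mm; apply: ip_eq0C; apply: norm_lt_eq0 => e e0.
have m0 : 0 < `|m| + 1 by rewrite ltr_wpDl.
pose e1 := e / 2 / (`|m| + 1); have e10 : 0 < e1 by rewrite !divr_gt0.
have /closure_normP/(_ _ e10)[q [Mq qe] pq] := Bp e1 e10.
have -> : x - p = (x - q) - (p - q) by rewrite opprB addrA subrK.
rewrite ipBl (le_lt_trans (ler_normB _ _))//.
have le1 : `|ip (x - q) m| <= e1 * `|m|.
  apply: (@ip_near_minimal d) => //; first exact: ltW.
  move=> t; rewrite -addrA -opprD; apply: dmin; apply: subspaceD => //.
  exact: subspaceZ.
have le2 : `|ip (p - q) m| <= e1 * `|m|.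
  by rewrite (le_trans (cauchy_schwarz _ _))// ler_wpM2r// ltW.
apply: (le_lt_trans (lerD le1 le2)).
rewrite -mulrDl (_ : e1 + e1 = e / (`|m| + 1)); last first.
  by rewrite /e1; field; rewrite gt_eqF.
by rewrite mulrAC ltr_pdivrMr// ltr_pM2l// ltrDl.
Qed.

Lemma orthocomp_subspace A : linear_subspace (orthocomp ip A).
Proof.
split=> [x _|a x y Ax Ay z Az]; first exact: ip0r.
by rewrite ipDr ipZr Ax// Ay// mulr0 addr0.
Qed.

Lemma closure_orthocomp A : closure (orthocomp ip A) = orthocomp ip A.
Proof.
apply/seteqP; split=> [y cly x Ax|]; last exact: subset_closure.
apply: ip_eq0C; move: y cly; suff: orthocomp ip (closure (orthocomp ip A)) x.
  by move=> Ax' y cly; exact: Ax'.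
by rewrite orthocomp_closure// => y Ay; apply: ip_eq0C; apply: Ay.
Qed.

Lemma closure_orthocomp_eq0 A x : closure A x -> orthocomp ip A x -> x = 0.
Proof.
by rewrite -orthocomp_closure => Ax Ax'; apply: ip_eq0; exact: Ax'.
Qed.

Lemma pythagoras x y : ip x y = 0 -> `|x + y| ^+ 2 = `|x| ^+ 2 + `|y| ^+ 2.
Proof. by move=> xy; rewrite norm_sqrD xy conjC0 !addr0. Qed.

Lemma adj_eq V V' : (forall x y, ip (V x) y = ip x (V' y)) -> adj ip V =1 V'.
Proof.
move=> VV' y; rewrite /adj; apply: xget_unique => [x|z Vz]; first exact: VV'.
apply/eqP; rewrite -subr_eq0; apply/eqP; apply: ip_eq0.
by rewrite ipBr -Vz VV' subrr.
Qed.

Lemma contraction_continuous (V : {linear H -> H}) :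
  (forall x, `|V x| <= `|x|) -> continuous V.
Proof.
move=> Vle x; apply/cvgrPdist_lt => e e0; near=> y.
rewrite -linearB (le_lt_trans (Vle _))//.
Unshelve. all: by end_near. Qed.

End InnerProduct.

(** * Isometric linear relations *)

Section Relations.
Variables (R : realType) (H : completeNormedModType R[i]).
Variable ip : {dot H for (@Num.conj R[i])}.
Hypothesis ip_norm : hilbert_norm ip.
Implicit Types (G : set (H * H)) (p q : H * H) (x y : H).

Definition rel_dom G : set H := [set p.1 | p in G].
Definition converse G : set (H * H) := [set p | G (p.2, p.1)].
Definition rel_cod G : set H := rel_dom (converse G).
Definition isometric G := forall p, G p -> `|p.1| = `|p.2|.

(** The graph of the operator that follows the closure of G on the closure of
    its domain and vanishes on the orthocomplement: p.1 is decomposed as m plus a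
    vector orthogonal to the domain, and only m is sent along G. *)
Definition zero_extension G : set (H * H) :=
  [set p | exists2 m, closure G (m, p.2) & orthocomp ip (rel_dom G) (p.1 - m)].

Lemma prod_norm_ltP p e : `|p| < e <-> `|p.1| < e /\ `|p.2| < e.
Proof.
rewrite prod_normE /Num.max; case: ifPn => [lt|nlt]; split=> [h|[]//].
  by split=> //; apply: lt_trans h.
split=> //; move: nlt; rewrite -real_leNgt// => nlt; exact: le_lt_trans h.
Qed.

Lemma closure_prodP G x y : closure G (x, y) <->
  forall e, 0 < e -> exists2 p, G p & `|x - p.1| < e /\ `|y - p.2| < e.
Proof.
rewrite (@closure_normP _ (H * H)%type); split=> clG e e0;
  have [p Gp xyp] := clG e e0; exists p => //;
  exact/(prod_norm_ltP ((x, y) - p)).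
Qed.

Lemma converseK G : converse (converse G) = G.
Proof. by apply/seteqP; split=> -[x y]. Qed.

Lemma closure_converse G : closure (converse G) = converse (closure G).
Proof.
apply/seteqP; split=> -[x y] => [/closure_prodP cl|/= /closure_prodP cl];
  apply/closure_prodP => e e0; have [[a b] Gp [xa yb]] := cl e e0;
  by exists (b, a).
Qed.

Lemma converse_subspace G : linear_subspace G -> linear_subspace (converse G).
Proof. by move=> [G0 GL]; split=> // a p q Gp Gq; exact: (GL a _ _ Gp Gq). Qed.

Lemma converse_isometric G : isometric G -> isometric (converse G).
Proof. by move=> Giso p /Giso. Qed.

Lemma rel_dom_closure G p : closure G p -> closure (rel_dom G) p.1.
Proof.
case: p => x y /closure_prodP cl; apply/closure_normP => e e0.
by have [p Gp []] := cl e e0; exists p.1 => //; exists p.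
Qed.

Lemma rel_cod_closure G p : closure G p -> closure (rel_cod G) p.2.
Proof.
move=> Gp; apply: (@rel_dom_closure _ (p.2, p.1)).
by rewrite closure_converse; case: p Gp.
Qed.

Lemma rel_dom_subspace G : linear_subspace G -> linear_subspace (rel_dom G).
Proof.
move=> [G0 GL]; split=> [|a _ _ [p Gp <-] [q Gq <-]]; first by exists 0.
by exists (a *: p + q) => //; apply: GL.
Qed.

Lemma closure_isometric G : isometric G -> isometric (closure G).
Proof.
move=> Giso [x y] /closure_prodP cl /=; apply/eqP; rewrite -subr_eq0; apply/eqP.
apply: norm_lt_eq0 => e e0; have [|p Gp [xp yp]] := cl (e / 2).
  by rewrite divr_gt0.
have -> : `|x| - `|y| = (`|x| - `|p.1|) - (`|y| - `|p.2|).
  by rewrite Giso// opprB addrA subrK.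
rewrite (le_lt_trans (ler_normB _ _))// [ltRHS](splitr e) ltrD//.
  by rewrite (le_lt_trans _ xp)// ler_dist_dist.
by rewrite (le_lt_trans _ yp)// ler_dist_dist.
Qed.

(** Polarization: applying the isometry to p + q and to p + i q recovers the
    real and the imaginary part of the inner products. *)
Lemma isometric_ip G p q : linear_subspace G -> isometric G -> G p -> G q ->
  ip p.1 q.1 = ip p.2 q.2.
Proof.
move=> G_lin Giso Gp Gq.
have re a : ip p.1 (a *: q.1) + (ip p.1 (a *: q.1))^* =
            ip p.2 (a *: q.2) + (ip p.2 (a *: q.2))^*.
  have Gaq : G (a *: q) by exact: subspaceZ.
  have := Giso _ (subspaceD G_lin Gp Gaq) => /= /(congr1 (fun t => t ^+ 2)).
  rewrite !(norm_sqrD ip_norm) (Giso _ Gp).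
  rewrite (Giso _ Gaq : `|a *: q.1| = `|a *: q.2|).
  exact: addrI.
have := re 1; have := re 'i; rewrite !scale1r !ipZr !rmorphM /= !conjCK conjCi.
move=> im r.
have {}im : ip p.1 q.1 - (ip p.1 q.1)^* = ip p.2 q.2 - (ip p.2 q.2)^*.
  apply: (mulfI (neq0Ci R[i])); move/(congr1 -%R): im.
  by rewrite !opprD !mulNr !opprK !mulrBr.
exact: add_sub_inj r im.
Qed.

(** An isometric linear relation is single-valued: it relates 0 to 0 only. *)
Lemma isometric_fun G x y y' : linear_subspace G -> isometric G ->
  G (x, y) -> G (x, y') -> y = y'.
Proof.
move=> G_lin Giso Gy Gy'; have := Giso _ (subspaceB G_lin Gy Gy') => /=.
by rewrite subrr normr0 => /esym/eqP; rewrite normr_eq0 subr_eq0 => /eqP.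
Qed.

(** The images of domain points near x are near each other, since G preserves
    distances; completeness provides their limit. *)
Lemma closure_rel_dom G x : linear_subspace G -> isometric G ->
  closure (rel_dom G) x -> exists y, closure G (x, y).
Proof.
move=> G_lin Giso /closure_normP clx.
pose B e := [set p.2 | p in [set p | G p /\ `|x - p.1| < e]].
have [e e0|e e' e0 ee' _ [p [Gp xp] <-]|e e0|y By] := @nested_closure _ H B.
- by have [_ [p Gp <-] xp] := clx e e0; exists p.2, p.
- by exists p => //; split=> //; apply: lt_le_trans ee'.
- exists (e / 2); first by rewrite divr_gt0.
  move=> _ _ [p [Gp xp] <-] [q [Gq xq] <-].
  rewrite -(Giso _ (subspaceB G_lin Gp Gq)) /=.
  have -> : p.1 - q.1 = (x - q.1) - (x - p.1) by rewrite opprB [RHS]addrC subrKA.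
  by rewrite (le_lt_trans (ler_normB _ _))// [ltRHS](splitr e) ltrD.
exists y; apply/closure_prodP => e e0.
have /closure_normP/(_ e e0)[_ [p [Gp xp] <-] yp] := By e e0.
by exists p.
Qed.

Lemma linear_of_graph G : linear_subspace G ->
    (forall y, G (0, y) -> y = 0) -> (forall x, exists y, G (x, y)) ->
  exists V : {linear H -> H}, forall x, G (x, V x).
Proof.
move=> G_lin G0 /choice[f Gf].
have fl : linear f.
  move=> a x y; apply/eqP; rewrite -subr_eq0; apply/eqP; apply: G0.
  have -> : (0, f (a *: x + y) - (a *: f x + f y)) =
            (a *: x + y, f (a *: x + y)) - (a *: (x, f x) + (y, f y)).
    by apply: injective_projections; rewrite /= ?subrr.
  by apply: subspaceB => //; apply: subspaceD => //; apply: subspaceZ.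
pose V : {linear H -> H} := HB.pack f (GRing.isLinear.Build _ _ _ _ f fl).
by exists V.
Qed.

Section ZeroExtension.
Variable G : set (H * H).
Hypotheses (G_lin : linear_subspace G) (G_iso : isometric G).

Let cG_lin : linear_subspace (closure G) := closure_subspace G_lin.
Let cG_iso : isometric (closure G) := closure_isometric G_iso.

Lemma zero_extension_subspace : linear_subspace (zero_extension G).
Proof.
have D_lin := orthocomp_subspace ip (rel_dom G).
split=> [|a p q [m Gm pm] [n Gn qn]].
  by exists 0; [case: cG_lin|rewrite /= subrr; case: D_lin].
exists (a *: m + n); first by case: cG_lin => _ cGL; exact: (cGL a _ _ Gm Gn).
rewrite /= opprD addrACA -scalerBr.
by case: D_lin => _ DL; exact: DL.
Qed.

Lemma zero_extension_fun x y y' :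
  zero_extension G (x, y) -> zero_extension G (x, y') -> y = y'.
Proof.
move=> E E'; have [m /= Gm] := subspaceB zero_extension_subspace E E'.
rewrite subrr sub0r => mD; apply/eqP; rewrite -subr_eq0; apply/eqP.
have m0 : m = 0.
  apply: (closure_orthocomp_eq0 ip_norm (rel_dom_closure Gm)).
  rewrite -[m]opprK -scaleN1r.
  exact: (subspaceZ (orthocomp_subspace ip _)).
have G0 : closure G (0, 0) by case: cG_lin.
by apply: (isometric_fun cG_lin cG_iso _ G0); rewrite -{1}m0.
Qed.

Lemma zero_extension_exists :
  exists V : {linear H -> H}, forall x, zero_extension G (x, V x).
Proof.
apply: linear_of_graph => [|y Gy|x]; first exact: zero_extension_subspace.
  have G0 : zero_extension G (0, 0) by case: zero_extension_subspace.
  exact: zero_extension_fun Gy G0.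
have [m Dm xm] := orthogonal_projection ip_norm x (rel_dom_subspace G_lin).
have [y Gy] := closure_rel_dom G_lin G_iso Dm.
by exists y, m.
Qed.

Lemma zero_extension_rel p : closure G p -> zero_extension G p.
Proof.
by exists p.1; [case: p H0|rewrite subrr => x _; rewrite ip0r].
Qed.

End ZeroExtension.

Section AdjointPair.
Variable G : set (H * H).
Hypotheses (G_lin : linear_subspace G) (G_iso : isometric G).
Variables V V' : {linear H -> H}.
Hypothesis V_graph : forall x, zero_extension G (x, V x).
Hypothesis V'_graph : forall y, zero_extension (converse G) (y, V' y).

Lemma zero_extension_eq x y : closure G (x, y) -> V x = y.
Proof. by move=> /zero_extension_rel; apply: zero_extension_fun (V_graph x). Qed.

(** Only the components along the closures of the domain and of the codomain
    contribute to either side, and there G preserves inner products. *)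
Lemma zero_extension_ip x y : ip (V x) y = ip x (V' y).
Proof.
have [m /= Gm xm] := V_graph x; have [n /=] := V'_graph y.
rewrite closure_converse /converse /= => Gn yn.
have Vn : ip (V x) (y - n) = 0.
  rewrite -(orthocomp_closure ip_norm) in yn; apply: yn.
  exact: (rel_cod_closure Gm).
have mV : ip (x - m) (V' y) = 0.
  rewrite -(orthocomp_closure ip_norm) in xm; apply: ip_eq0C; apply: xm.
  exact: (rel_dom_closure Gn).
have := isometric_ip (closure_subspace G_lin) (closure_isometric G_iso) Gm Gn.
move=> /= mn.
rewrite -[in LHS](subrK n y) ipDr Vn add0r -mn.
by rewrite -[in RHS](subrK m x) ipDl mV add0r.
Qed.

Lemma zero_extension_adj : adj ip V =1 V'.
Proof. exact: (adj_eq ip_norm) zero_extension_ip. Qed.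


(** [V' \o V] is the orthogonal projection onto the closed domain of G. *)
Lemma zero_extension_adjK x :
  closure (rel_dom G) (V' (V x)) /\ orthocomp ip (rel_dom G) (x - V' (V x)).
Proof.
have [m /= Gm xm] := V_graph x.
have Gm' : closure (converse G) (V x, m) by rewrite closure_converse.
have -> : V' (V x) = m.
  apply: (zero_extension_fun (converse_subspace G_lin)
    (converse_isometric G_iso) (V'_graph (V x))).
  exact: zero_extension_rel.
by split=> //; exact: rel_dom_closure Gm.
Qed.

Lemma zero_extension_adjK_id x : closure (rel_dom G) x -> V' (V x) = x.
Proof.
move=> Gx; have [Gy xy] := zero_extension_adjK x; apply/esym/eqP.
rewrite -subr_eq0; apply/eqP; apply: (closure_orthocomp_eq0 ip_norm _ xy).
exact: (subspaceB (closure_subspace (rel_dom_subspace G_lin)) Gx Gy).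
Qed.

Lemma zero_extension_norm x :
  `|x| ^+ 2 = `|V x| ^+ 2 + `|x - V' (V x)| ^+ 2.
Proof.
have [Gy xy] := zero_extension_adjK x.
have {xy} xy : ip (x - V' (V x)) (V' (V x)) = 0.
  by rewrite -(orthocomp_closure ip_norm) in xy; apply: ip_eq0C; apply: xy.
rewrite -{1}(subrK (V' (V x)) x) (pythagoras ip_norm xy) addrC; congr (_ + _).
rewrite !ip_norm zero_extension_ip.
by have := ipDl ip (x - V' (V x)) (V' (V x)) (V' (V x)); rewrite subrK xy add0r.
Qed.

Lemma zero_extension_le x : `|V x| <= `|x|.
Proof.
rewrite -(ler_sqr (normr_ge0 _)) ?nnegrE// (zero_extension_norm x).
by rewrite lerDl exprn_ge0.
Qed.

(** Norm is lost as soon as x has a component orthogonal to the domain. *)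
Lemma zero_extension_norm_eq x : `|V x| = `|x| -> closure (rel_dom G) x.
Proof.
move=> Vx; have := zero_extension_norm x; rewrite Vx -{1}[_ ^+ 2]addr0.
move=> /addrI/esym/eqP; rewrite sqrf_eq0 normr_eq0 subr_eq0 => /eqP ->.
by have [] := zero_extension_adjK x.
Qed.

Lemma zero_extension_initial_space :
  initial_space ip V = closure (rel_dom G).
Proof.
apply/seteqP; split=> [_ [x _ <-]|x Gx] /=.
  by rewrite zero_extension_adj; have [] := zero_extension_adjK x.
by exists x => //=; rewrite zero_extension_adj zero_extension_adjK_id.
Qed.

Lemma zero_extension_partial_isometry : partial_isometry ip V.
Proof.
split=> [|x /=]; first exact: contraction_continuous zero_extension_le.
rewrite !zero_extension_adj zero_extension_adjK_id//.
by have [] := zero_extension_adjK x.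
Qed.

End AdjointPair.

Lemma zero_extension_final_space G (V V' : {linear H -> H}) :
    linear_subspace G -> isometric G ->
    (forall x, zero_extension G (x, V x)) ->
    (forall y, zero_extension (converse G) (y, V' y)) ->
  final_space ip V = closure (rel_cod G).
Proof.
move=> G_lin G_iso VG V'G.
have VG' x : zero_extension (converse (converse G)) (x, V x).
  by rewrite converseK.
have cG_lin := converse_subspace G_lin; have cG_iso := converse_isometric G_iso.
rewrite -(zero_extension_initial_space cG_lin cG_iso V'G VG').
congr (_ @` _); apply/funext => y /=.
rewrite (zero_extension_adj G_lin G_iso VG V'G).
by rewrite (zero_extension_adj cG_lin cG_iso V'G VG').
Qed.

Lemma zero_extension_pair G : linear_subspace G -> isometric G ->
  exists V V' : {linear H -> H}, (forall x, zero_extension G (x, V x)) /\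
    (forall y, zero_extension (converse G) (y, V' y)).
Proof.
move=> G_lin G_iso; have [V VG] := zero_extension_exists G_lin G_iso.
have [V' V'G] := zero_extension_exists (converse_subspace G_lin)
  (converse_isometric G_iso).
by exists V, V'.
Qed.

End Relations.

(** * Cayley graphs *)

Section CayleyTransform.
Variables (R : realType) (H : completeNormedModType R[i]).
Variable ip : {dot H for (@Num.conj R[i])}.
Hypothesis ip_norm : hilbert_norm ip.
Implicit Types (S T : operator H) (x y : H).

Lemma ipZil x y : ip ('i *: x) y = 'i * ip x y.
Proof. exact: ipZl. Qed.

Lemma ipZir x y : ip x ('i *: y) = - ('i * ip x y).
Proof. by rewrite ipZr conjCi mulNr. Qed.

Lemma cayley_subspace S : linear_subspace (cayley_graph S).
Proof.
have op0 : S 0 = 0.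
  have := op_linear (-1) (dom0 S) (dom0 S).
  by rewrite scaler0 addr0 scaleN1r addNr.
split=> [|a _ _ [x Sx <-] [y Sy <-]].
  by exists 0; [exact: dom0|rewrite op0 scaler0 addr0 subr0].
exists (a *: x + y); first exact: dom_linear.
rewrite op_linear//; apply: injective_projections => /=.
  rewrite !scalerDr !scalerN !scalerA opprD addrACA.
  by rewrite [a * 'i]mulrC.
by rewrite !scalerDr !scalerA addrACA [a * 'i]mulrC.
Qed.

Lemma cayley_isometric S : hermitian_op ip S -> isometric (cayley_graph S).
Proof.
move=> [_ S_herm] _ [x Sx <-] /=.
have real_ip : (ip (S x) x)^* = ip (S x) x by rewrite -ipC S_herm.
have d0 : ip (S x) ('i *: x) + (ip (S x) ('i *: x))^* = 0.
  by rewrite ipZir rmorphN rmorphM /= real_ip conjCi mulNr opprK addNr.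
apply/eqP; rewrite -(@eqrXn2 _ 2)//; apply/eqP.
by rewrite (norm_sqrB ip_norm) (norm_sqrD ip_norm) d0 subr0 addr0.
Qed.

Lemma cayley_dom S :
  rel_dom (cayley_graph S) = [set S x - 'i *: x | x in dom S].
Proof.
apply/seteqP; split=> y; first by move=> [_ [x Sx <-] <-]; exists x.
by move=> [x Sx <-]; exists (S x - 'i *: x, S x + 'i *: x) => //; exists x.
Qed.

Lemma cayley_cod S :
  rel_cod (cayley_graph S) = [set S x + 'i *: x | x in dom S].
Proof.
apply/seteqP; split=> y; first by move=> [[a b] [x Sx [/= _ <-]] <-]; exists x.
by move=> [x Sx <-]; exists (S x + 'i *: x, S x - 'i *: x) => //; exists x.
Qed.

Lemma cayley_dom_orthocomp S :
  orthocomp ip (rel_dom (cayley_graph S)) = defect_space ip S (- 'i).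
Proof.
have E x y : ip (S x - 'i *: x) y = ip (S x) y - ip x (- 'i *: y).
  by rewrite ipBl ipZil scaleNr -scaleN1r ipZr ipZir rmorphN1 mulN1r opprK.
rewrite cayley_dom; apply/seteqP; split=> y /= Sy x.
  by move=> Sx; apply/eqP; rewrite -subr_eq0 -E Sy//; exists x.
by move=> [z Sz <-]; rewrite E Sy// subrr.
Qed.

Lemma cayley_cod_orthocomp S :
  orthocomp ip (rel_cod (cayley_graph S)) = defect_space ip S 'i.
Proof.
have E x y : ip (S x + 'i *: x) y = ip (S x) y - ip x ('i *: y).
  by rewrite ipDl ipZil ipZir opprK.
rewrite cayley_cod; apply/seteqP; split=> y /= Sy x.
  by move=> Sx; apply/eqP; rewrite -subr_eq0 -E Sy//; exists x.
by move=> [z Sz <-]; rewrite E Sy// subrr.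
Qed.

(** The two defect spaces of a densely defined operator meet in 0: a common
    vector is orthogonal to the difference 2 i x of S x + i x and S x - i x, for
    every x in the domain. *)
Lemma cayley_orthocomp_eq0 S y : dense (dom S) ->
    orthocomp ip (rel_dom (cayley_graph S)) y ->
    orthocomp ip (rel_cod (cayley_graph S)) y ->
  y = 0.
Proof.
rewrite cayley_dom cayley_cod => S_dense yd yc.
apply: (ip_dense_eq0 ip_norm S_dense) => x Sx.
have /yd : [set S x - 'i *: x | x in dom S] (S x - 'i *: x) by exists x.
have /yc : [set S x + 'i *: x | x in dom S] (S x + 'i *: x) by exists x.
rewrite ipBl ipDl ipZil => yc' yd'; apply: (mulfI (neq0Ci R[i])).
rewrite mulr0; apply: (@add_sub_inj _ _ (ip (S x) y) _ 0).
  by rewrite [LHS]addrC yc' addr0.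
by rewrite -opprB yd' subr0 oppr0.
Qed.

Lemma zero_extension_cayley_transform S (V V' : {linear H -> H}) :
    hermitian_op ip S ->
    (forall x, zero_extension ip (cayley_graph S) (x, V x)) ->
    (forall y, zero_extension ip (converse (cayley_graph S)) (y, V' y)) ->
  cayley_transform ip S V.
Proof.
move=> S_herm VG V'G.
have G_lin := cayley_subspace S; have G_iso := cayley_isometric S_herm; split.
- exact: zero_extension_partial_isometry V'G.
- by rewrite -cayley_dom; apply: zero_extension_initial_space V'G.
- move=> x Sx; apply: (zero_extension_eq ip_norm G_lin G_iso VG).
  by apply: subset_closure; exists x.
Qed.

Lemma self_adjoint_hermitian T : self_adjoint ip T -> hermitian_op ip T.
Proof.
move=> [T_dense TE]; split=> // x y Tx Ty.
have : adjoint_graph ip T (y, T y) by rewrite -TE; exists y.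
by apply.
Qed.

(** The Cayley graph is the image of the graph of T under a bijection of H * H,
    so a limit (y, z) of it comes from some (x, w), and the claim is that (x, w)
    lies in the graph of T, that is, of its adjoint. Inner products being
    preserved by the closure of the Cayley graph, (y, z) may be compared with the
    pair given by any u in the domain; expanding, this says
    <T u, x> = <u, w>. *)
Lemma self_adjoint_cayley_closed T : self_adjoint ip T ->
  closure (cayley_graph T) = cayley_graph T.
Proof.
move=> T_sa; have [_ TE] := T_sa.
apply/seteqP; split=> [[y z]|]; last exact: subset_closure.
move=> clG.
(* obtained by solving y = w - i x and z = w + i x *)
pose x := (2 * 'i)^-1 *: (z - y); pose w := 2^-1 *: (z + y).
have i2 : 2 * 'i != 0 :> R[i] by rewrite mulf_neq0 ?pnatr_eq0 ?neq0Ci.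
have ix : 'i *: x = 2^-1 *: (z - y).
  by rewrite /x scalerA; congr (_ *: _); field; rewrite neq0Ci.
have half u : 2^-1 *: (u + u) = u :> H.
  by rewrite -[u in u + u]scale1r -scalerDl scalerA mulVf ?scale1r// pnatr_eq0.
have yE : w - 'i *: x = y.
  by rewrite ix -scalerBr opprB [z + y]addrC addrACA subrr addr0 half.
have zE : w + 'i *: x = z.
  by rewrite ix -scalerDr addrACA subrr addr0 half.
suff : adjoint_graph ip T (x, w).
  rewrite -TE => -[x' Tx [xx' wx']]; exists x'; first by [].
  by rewrite wx' xx' yE zE.
move=> u Tu /=.
have Gu : closure (cayley_graph T) (T u - 'i *: u, T u + 'i *: u).
  by apply: subset_closure; exists u.
have := isometric_ip ip_norm (closure_subspace (cayley_subspace T))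
  (closure_isometric (cayley_isometric (self_adjoint_hermitian T_sa))) Gu clG.
rewrite /= -yE -zE ipBl ipDl !ipBr !ipDr !ipZil !ipZir => E.
have {E} : 'i * (ip (T u) x - ip u w) = 0.
  apply: (mulfI (_ : 2 != 0 :> R[i])); first by rewrite pnatr_eq0.
  by move/eqP: E; rewrite mulr0 -subr_eq0 => /eqP <-; ring.
by move=> /eqP; rewrite mulf_eq0 (negbTE (neq0Ci _)) subr_eq0 => /eqP.
Qed.

Lemma self_adjoint_eigen T (z : R[i]) y : self_adjoint ip T ->
  defect_space ip T z y -> dom T y /\ T y = z *: y.
Proof.
by move=> [_ TE]; rewrite /defect_space /= -TE => -[x Tx [<- <-]].
Qed.

(** A vector y orthogonal to the range of T - i satisfies T y = - i y, so that
    the isometric Cayley graph relates - 2 i y to 0. *)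
Lemma self_adjoint_cayley_dom0 T y : self_adjoint ip T ->
  orthocomp ip (rel_dom (cayley_graph T)) y -> y = 0.
Proof.
move=> T_sa; rewrite cayley_dom_orthocomp => /(self_adjoint_eigen T_sa)[Ty TyE].
have /(cayley_isometric (self_adjoint_hermitian T_sa)) :
  cayley_graph T (T y - 'i *: y, T y + 'i *: y) by exists y.
rewrite /= TyE scaleNr addNr normr0 -opprD -mulr2n -scaler_nat => /eqP.
by rewrite normrN normr_eq0 !scaler_eq0 pnatr_eq0 (negbTE (neq0Ci _)) => /eqP.
Qed.

Lemma self_adjoint_cayley_cod0 T y : self_adjoint ip T ->
  orthocomp ip (rel_cod (cayley_graph T)) y -> y = 0.
Proof.
move=> T_sa; rewrite cayley_cod_orthocomp => /(self_adjoint_eigen T_sa)[Ty TyE].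
have /(cayley_isometric (self_adjoint_hermitian T_sa)) :
  cayley_graph T (T y - 'i *: y, T y + 'i *: y) by exists y.
rewrite /= TyE subrr normr0 -mulr2n -scaler_nat => /esym/eqP.
by rewrite normr_eq0 !scaler_eq0 pnatr_eq0 (negbTE (neq0Ci _)) => /eqP.
Qed.

Lemma self_adjoint_cayley_transform T : self_adjoint ip T ->
  exists2 U : {linear H -> H}, unitary_cayley_transform ip T U &
    forall x, cayley_graph T (x, U x).
Proof.
move=> T_sa; have T_herm := self_adjoint_hermitian T_sa.
have G_lin := cayley_subspace T; have G_iso := cayley_isometric T_herm.
have cG_lin := converse_subspace G_lin; have cG_iso := converse_isometric G_iso.
have [U [U' [UE U'E]]] := zero_extension_pair ip_norm G_lin G_iso.
have UG x : cayley_graph T (x, U x).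
  have [m /=] := UE x; rewrite self_adjoint_cayley_closed// => Gm.
  by move=> /(self_adjoint_cayley_dom0 T_sa)/eqP; rewrite subr_eq0 => /eqP {1}->.
have U'G y : cayley_graph T (U' y, y).
  have [m /=] := U'E y.
  rewrite closure_converse self_adjoint_cayley_closed// => Gm.
  move=> /(self_adjoint_cayley_cod0 T_sa)/eqP; rewrite subr_eq0 => /eqP ym.
  by rewrite {2}ym; exact: Gm.
have U'U x : U' (U x) = x.
  exact: (isometric_fun cG_lin cG_iso (U'G (U x)) (UG x)).
have UU' y : U (U' y) = y.
  exact: (isometric_fun G_lin G_iso (UG (U' y)) (U'G y)).
exists U => //; split.
  have adjU := zero_extension_adj ip_norm G_lin G_iso UE U'E.
  by split=> x; rewrite adjU ?U'U ?UU'.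
apply/seteqP; split=> [_ [x _ <-]|[x y] Gxy]; first exact: UG.
by exists x => //; rewrite (isometric_fun G_lin G_iso (UG x) Gxy).
Qed.

End CayleyTransform.

(** * Self-adjoint extensions *)

Section SelfAdjointExtension.
Variables (R : realType) (H : completeNormedModType R[i]).
Variable ip : {dot H for (@Num.conj R[i])}.
Hypothesis ip_norm : hilbert_norm ip.
Variables S T : operator H.
Hypothesis T_sa : self_adjoint ip T.
Hypothesis ST : extends T S.

Let D := rel_dom (cayley_graph S).
Let N := rel_cod (cayley_graph S).

Let T_lin := cayley_subspace T.
Let T_iso := cayley_isometric ip_norm (self_adjoint_hermitian T_sa).

Lemma extends_cayley : cayley_graph S `<=` cayley_graph T.
Proof.
move=> _ [x Sx <-]; have /ST[y Ty [yx TyE]] : op_graph S (x, S x) by exists x.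
by exists y => //; rewrite TyE yx.
Qed.

(** The relation whose zero extension is W: what the Cayley graph of T adds to
    that of S. *)
Definition defect_relation : set (H * H) :=
  [set p | cayley_graph T p /\ orthocomp ip D p.1].

Lemma defect_relation_subspace : linear_subspace defect_relation.
Proof.
have D_lin := orthocomp_subspace ip D.
split=> [|a p q [Tp Dp] [Tq Dq]]; first by split; [case: T_lin|case: D_lin].
by split; [case: T_lin => _; apply|case: D_lin => _; apply].
Qed.

Lemma defect_relation_isometric : isometric defect_relation.
Proof. by move=> p [/T_iso]. Qed.

Variable U : {linear H -> H}.
Hypothesis UG : forall x, cayley_graph T (x, U x).
Hypothesis U_onto : forall y, exists x, U x = y.

Lemma defect_relation_dom : rel_dom defect_relation = orthocomp ip D.
Proof.
apply/seteqP; split=> [_ [p [_ Dp] <-//]|x Dx].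
by exists (x, U x) => //; split=> //; exact: UG.
Qed.

(** Orthogonality to the Cayley graph of S passes from first to second
    components and back, since the Cayley graph of T contains that of S and
    preserves inner products. *)
Lemma defect_relation_cod : rel_cod defect_relation = orthocomp ip N.
Proof.
apply/seteqP; split=> [_ [[f e] [/= Tef De] <-] _ [[b a] /= Sab <-]|y Ny].
  rewrite -(isometric_ip ip_norm T_lin T_iso (extends_cayley Sab) Tef) /=.
  by apply: De; exists (a, b).
have [x xy] := U_onto y; exists (y, x) => //; split.
  by rewrite /= -xy; exact: UG.
move=> _ [[a b] Sab <-] /=.
have := isometric_ip ip_norm T_lin T_iso (extends_cayley Sab) (UG x) => /= ->.
by rewrite xy; apply: Ny; exists (b, a).
Qed.

Variables V W : {linear H -> H}.
Hypothesis VG : forall x, zero_extension ip (cayley_graph S) (x, V x).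
Hypothesis WG : forall x, zero_extension ip defect_relation (x, W x).

(** The vectors m and n in which V and W decompose x are its components in the
    closure of D and in its orthocomplement, hence add up to x; the pairs
    (m, V x) and (n, W x) both lie in the closed graph of U. *)
Lemma cayley_extension_sum x : U x = V x + W x.
Proof.
have T_closed := self_adjoint_cayley_closed ip_norm T_sa.
have [m /= Vm xm] := VG x; have [n /= Wn] := WG x.
have Dm : closure D m := rel_dom_closure Vm.
have Dn : orthocomp ip D n.
  by have := rel_dom_closure Wn; rewrite defect_relation_dom closure_orthocomp.
rewrite defect_relation_dom => xn.
have mn : x = m + n.
  apply/eqP; rewrite -subr_eq0 opprD addrA; apply/eqP; apply: (ip_eq0 ip_norm).
  have xmn : orthocomp ip D (x - m - n).
    exact: (subspaceB (orthocomp_subspace ip D)).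
  rewrite {2}addrAC ipBr xn//.
  rewrite -(orthocomp_closure ip_norm) in xmn.
  by rewrite (ip_eq0C (xmn _ Dm)) subrr.
have TV : cayley_graph T (m, V x).
  by rewrite -T_closed; apply: closure_subset Vm; exact: extends_cayley.
have TW : cayley_graph T (n, W x).
  by rewrite -T_closed; apply: closure_subset Wn => p [].
apply: (isometric_fun T_lin T_iso (UG x)); rewrite {1}mn.
exact: (subspaceD T_lin TV TW).
Qed.

End SelfAdjointExtension.

Lemma has_dim1 (R : realType) (H : completeNormedModType R[i]) (A : set H) :
  has_dim A 1 -> exists2 f : H, f != 0 & A = [set c *: f | c in [set: R[i]]].
Proof.
move=> [e [e_free AE]]; exists (e ord0).
  apply/eqP => e0; have /e_free/(_ ord0)/eqP : \sum_i (1 : R[i]) *: e i = 0.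
    by rewrite big_ord1 e0 scaler0.
  by rewrite oner_eq0.
rewrite AE; apply/seteqP; split=> _ [c _ <-] /=.
  by exists (c ord0) => //; rewrite big_ord1.
by exists (fun=> c) => //; rewrite big_ord1.
Qed.

Theorem proposition5p2 (R : realType) (H : completeNormedModType R[i])
    (ip : {dot H for (@Num.conj R[i])}) (ip_norm : hilbert_norm ip)
    (H_dim : countably_infinite_dim ip)
    (S : operator H) (S_herm : hermitian_op ip S)
    (S_def : deficiency_indices ip S 1 1) :
  exists V : {linear H -> H}, cayley_transform ip S V /\
    forall T : operator H, extends T S -> self_adjoint ip T ->
    exists U W : {linear H -> H},
      [/\ unitary_cayley_transform ip T U,
          is_orthosum ip U V W,
          rank_is (adj ip W \o W) 1,
          rank_is (W \o adj ip W) 1 &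
          exists alpha : R[i],
            `|alpha| < 1 /\ forall x, W (W x) = alpha *: W x].
Proof.
have G_lin := cayley_subspace S; have G_iso := cayley_isometric ip_norm S_herm.
have [V [V' [VG V'G]]] := zero_extension_pair ip_norm G_lin G_iso.
exists V; split; first exact: zero_extension_cayley_transform V'G.
move=> T ST T_sa.
have [U U_cayley UG] := self_adjoint_cayley_transform ip_norm T_sa.
have U_onto y : exists x, U x = y.
  have [[_ UU'] _] := U_cayley; exists (adj ip U y); exact: UU'.
have W_lin := defect_relation_subspace ip S T.
have W_iso := defect_relation_isometric ip_norm (S := S) T_sa.
have [W [W' [WG W'G]]] := zero_extension_pair ip_norm W_lin W_iso.
have W_init : initial_space ip W = defect_space ip S (- 'i).
  rewrite (zero_extension_initial_space ip_norm W_lin W_iso WG W'G).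
  rewrite (defect_relation_dom ip S UG) closure_orthocomp//.
  by rewrite cayley_dom_orthocomp.
have W_final : final_space ip W = defect_space ip S 'i.
  rewrite (zero_extension_final_space ip_norm W_lin W_iso WG W'G).
  rewrite (defect_relation_cod ip_norm T_sa ST UG U_onto).
  by rewrite closure_orthocomp// cayley_cod_orthocomp.
have [N_dim D_dim] := S_def.
exists U, W; split=> //.
- split.
  + exact: zero_extension_partial_isometry W'G.
  + rewrite (zero_extension_initial_space ip_norm G_lin G_iso VG V'G).
    by rewrite orthocomp_closure// cayley_dom_orthocomp.
  + rewrite (zero_extension_final_space ip_norm G_lin G_iso VG V'G).
    by rewrite orthocomp_closure// cayley_cod_orthocomp.
  + exact: (cayley_extension_sum ip_norm T_sa ST UG VG WG).
- by rewrite -W_init in D_dim.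
- by rewrite -W_final in N_dim.
have WN x : defect_space ip S 'i (W x).
  have [m /= Wm _] := WG x; have := rel_cod_closure Wm => /=.
  rewrite (defect_relation_cod ip_norm T_sa ST UG U_onto).
  by rewrite closure_orthocomp// cayley_cod_orthocomp.
have [f f0 NE] := has_dim1 N_dim.
have [alpha _ Wf] : [set c *: f | c in [set: R[i]]] (W f) by rewrite -NE.
exists alpha; split=> [|x]; last first.
  have [c _ <-] : [set c *: f | c in [set: R[i]]] (W x) by rewrite -NE.
  by rewrite linearZZ -Wf !scalerA mulrC.
have nf : 0 < `|f| by rewrite normr_gt0.
rewrite -(ltr_pM2r nf) mul1r -normrZ Wf lt_neqAle.
rewrite (zero_extension_le ip_norm W_lin W_iso WG W'G) andbT.
(* |W f| = |f| would place f in both defect spaces *)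
apply: contra f0 => /eqP.
move=> /(zero_extension_norm_eq ip_norm W_lin W_iso WG W'G).
rewrite (defect_relation_dom ip S UG) closure_orthocomp// => Df; apply/eqP.
have [S_dense _] := S_herm.
apply: (cayley_orthocomp_eq0 ip_norm S_dense Df).
by rewrite cayley_cod_orthocomp NE; exists 1 => //; rewrite scale1r.
Qed.
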